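(* Let $G$ be a relatively hyperbolic group, hyperbolic relative to the peripheral subgroups $\mathcal{H}=\{H_i\}_{i\in I}$, with finite generating set $X$, and suppose that the Conjugacy Search Problem (CSP) in all peripheral subgroups $H_i$ can be bounded by a polynomial $\mathcal{P}$ of degree $n$. Then the CSP in $G$ is bounded by a polynomial function of degree $\max\{3,2n+1\}$. That is, there is a polynomial $\mathcal{Q}$ of degree $\max\{3,2n+1\}$ such that for any two elements $a,b\in G$ which are conjugate in $G$, with $\mathcal{L}=\max\{\|a\|_X,\|b\|_X\}$, there exists $x\in G$ with $x^{-1}ax=b$ and $\|x\|_X\le \mathcal{Q}(\mathcal{L})$.
   Context: Let $G$ be a finitely generated group with finite generating set $X$ and let $\mathcal{H}=\{H_i\}_{i\in I}$ be a set of subgroups of $G$ (the peripheral subgroups). $\|x\|_X$ is the word length of $x$ with respect to $X$. $\Gamma=\Gamma(G,X)$ is the Cayley graph with path metric $d_\Gamma$, and $\widehat{\Gamma}=\Gamma(G,X\cup\mathcal{H})$ is the coned-off Cayley graph, i.e. the Cayley graph of $G$ with respect to $X\cup\bigcup_{i}H_i$, with path metric $d_{\widehat\Gamma}$. Relative hyperbolicity (Farb): $G$ is weakly relatively hyperbolic with respect to $\mathcal{H}$ if $\widehat\Gamma$ is a hyperbolic metric space. A relative (quasi-)geodesic is a (quasi-)geodesic in $\widehat\Gamma$. An $H_i$-component of a path is a maximal subpath labelled by an element of $H_i$; a path penetrates a coset $gH_i$ if it has an $H_i$-component in that coset. Two $H_i$-components $s,t$ are connected if there is a path from the origin $s_-$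 to the origin $t_-$ labelled by an element of $H_i$; a component of a single path is isolated if no distinct $H_i$-component of that path is connected to it; a path is without backtracking if all its $H_i$-components (for all $i$) are isolated. The Bounded Coset Penetration property (BCP) says: for any $\lambda$ there is a constant $c(\lambda)$ such that for any two relative $(\lambda,0)$-quasi-geodesics $p,q$ without backtracking with the same endpoints, (1) if both penetrate the same coset then they enter (and leave) it a $\Gamma$-distance at most $c(\lambda)$ apart; (2) if $p$ penetrates a coset $gH_i$ which $q$ does not penetrate, then $p$ travels a $\Gamma$-distance at most $c(\lambda)$ in $gH_i$. $G$ is hyperbolic relative to $\mathcal{H}$ if it is weakly relatively hyperbolic with respect to $\mathcal{H}$ and satisfies BCP. In this case $\mathcal{H}$ is finite and each $H_i$ is finitely generated. CSP bounds: the CSP in a finitely generated group $K$ (with a finite generating set and corresponding word length) is bounded by a function $f$ if for any $a,b\in K$ conjugate in $K$ there is $x\in K$ with $x^{-1}ax=b$ and with the length of $x$ at most $f(\max\{\text{length of }a,\text{length of }b\})$. *)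

(* Defs.v *)
From HB Require Import structures.
From mathcomp Require Import all_boot all_order all_algebra.
From mathcomp Require Import all_classical all_reals.

Set Implicit Arguments.
Unset Strict Implicit.
Unset Printing Implicit Defensive.

Import Order.TTheory GRing.Theory Num.Theory.

Local Open Scope classical_set_scope.
Local Open Scope ring_scope.

(* Combinatorial paths in the Cayley graph of G with respect to an alphabet
   S : the edges are (g, g * s) with s in S or s^-1 in S, so that a path is
   given by its origin and its label. *)
Record cpath (G : groupType) := CPath { origin : G; label : seq G }.

Section CayleyGraph.
Variable G : groupType.
Implicit Types (S : set G) (p : cpath G) (g h : G).

Definition plength p : nat := size (label p).

Definition vertex p (k : nat) : G :=
  (origin p * \prod_(s <- take k (label p)) s)%g.

Definition terminus p : G := vertex p (plength p).

Definition is_path S p : Prop :=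
  forall s, s \in label p -> S s \/ S (s^-1)%g.

(* The value is irrelevant (0) when g and h are not joined by a path. *)
Definition cayley_dist S g h : nat :=
  let lengths := [set n | exists p,
    [/\ is_path S p, origin p = g, terminus p = h & plength p = n]] in
  xget 0%N [set n | lengths n /\ forall m, lengths m -> (n <= m)%N].

Definition word_length S g : nat := cayley_dist S 1%g g.

Definition generates (X : seq G) (K : set G) : Prop :=
  (forall x, x \in X -> K x) /\
  (forall g, K g -> exists p,
    [/\ is_path [set` X] p, origin p = 1%g & terminus p = g]).

Definition geodesic S p : Prop :=
  is_path S p /\ plength p = cayley_dist S (origin p) (terminus p).

(* For a path parametrized by arc length the other inequality in the usual
   definition, d(p(j), p(k)) <= lambda |j - k| + eps, is automatic. *)
Definition quasi_geodesic (R : realType) S (lambda eps : R) p : Prop :=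
  is_path S p /\
  forall j k, (j <= k <= plength p)%N ->
    (k - j)%N%:R <= lambda * (cayley_dist S (vertex p j) (vertex p k))%:R + eps.

(* Rips' condition: geodesic triangles are delta-slim. *)
Definition hyperbolic_graph (R : realType) S : Prop :=
  exists delta : R, forall p q r,
    geodesic S p -> geodesic S q -> geodesic S r ->
    terminus p = origin q -> terminus q = origin r -> terminus r = origin p ->
    forall k, (k <= plength p)%N ->
      (exists2 j, (j <= plength q)%N &
         (cayley_dist S (vertex p k) (vertex q j))%:R <= delta) \/
      (exists2 j, (j <= plength r)%N &
         (cayley_dist S (vertex p k) (vertex r j))%:R <= delta).

End CayleyGraph.

Section Components.
Variable G : groupType.
Implicit Types (K : groupClosed G) (p : cpath G).

Definition labelled_in K p (a b : nat) : Prop :=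
  forall k, (a <= k < b)%N -> nth 1%g (label p) k \in K.

(* The subpath of p from vertex a to vertex b is a K-component: it is
   nonempty, all its edges are labelled by elements of K, and it is maximal
   among such subpaths.  Requiring only that the product of the labels lies in
   K would be a different notion, for which every path is without
   backtracking. *)
Definition component K p (a b : nat) : Prop :=
  [/\ (a < b <= plength p)%N, labelled_in K p a b &
      forall a' b', (a' <= a)%N -> (b <= b' <= plength p)%N ->
        labelled_in K p a' b' -> a' = a /\ b' = b].

(* Only the origins of the two components matter. *)
Definition connected_at K p (a a' : nat) : Prop :=
  exists2 h, h \in K & (vertex p a * h)%g = vertex p a'.

Definition isolated K p (a b : nat) : Prop :=
  forall a' b', component K p a' b' -> connected_at K p a a' ->
    a' = a /\ b' = b.

Definition in_coset K (g x : G) : Prop := exists2 h, h \in K & x = (g * h)%g.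

(* p penetrates g K along its K-component from vertex a to vertex b. *)
Definition penetrates_at K p (g : G) (a b : nat) : Prop :=
  component K p a b /\ in_coset K g (vertex p a).

Definition penetrates K p (g : G) : Prop :=
  exists a b, penetrates_at K p g a b.

End Components.

Section RelativeHyperbolicity.
Variables (R : realType) (G : groupType) (X : seq G).
Variables (I : Type) (H : I -> groupClosed G).

Definition relative_alphabet : set G :=
  [set` X] `|` \bigcup_(i in [set: I]) [set x | x \in H i].

Definition without_backtracking (p : cpath G) : Prop :=
  forall i a b, component (H i) p a b -> isolated (H i) p a b.

Definition BCP : Prop :=
  forall lambda : R, exists c : R, forall p q : cpath G,
    quasi_geodesic relative_alphabet lambda 0 p ->
    quasi_geodesic relative_alphabet lambda 0 q ->
    without_backtracking p -> without_backtracking q ->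
    origin p = origin q -> terminus p = terminus q ->
    (forall i g a b a' b',
       penetrates_at (H i) p g a b -> penetrates_at (H i) q g a' b' ->
       (cayley_dist [set` X] (vertex p a) (vertex q a'))%:R <= c /\
       (cayley_dist [set` X] (vertex p b) (vertex q b'))%:R <= c) /\
    (forall i g a b,
       penetrates_at (H i) p g a b -> ~ penetrates (H i) q g ->
       (cayley_dist [set` X] (vertex p a) (vertex p b))%:R <= c).

Definition weakly_relatively_hyperbolic : Prop :=
  hyperbolic_graph R relative_alphabet.

Definition relatively_hyperbolic : Prop :=
  weakly_relatively_hyperbolic /\ BCP.

End RelativeHyperbolicity.

(* [a ^ x] is [x^-1 * (a * x)]. *)
Definition CSP_bounded (R : realType) (G : groupType) (K : set G) (X : seq G)
    (f : R -> R) : Prop :=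
  forall a b, K a -> K b -> (exists2 x, K x & (a ^ x)%g = b) ->
    exists x, [/\ K x, (a ^ x)%g = b &
      (word_length [set` X] x)%:R <=
        f (maxn (word_length [set` X] a) (word_length [set` X] b))%:R].

(* Main.v *)
Require Import Defs.
From mathcomp Require Import all_boot all_order all_algebra.
From mathcomp Require Import all_classical all_reals.
From mathcomp Require Import zify.

(* The only consequence of BCP that is used is isolated_bound: two points of a
   peripheral coset C joined by a relative path of length at most N without edges
   in C are at bounded X-distance.  With slim quadrangles it shows that a relative
   geodesic without edges in C has a projection to C of bounded X-diameter.
   Hence an X-path of length l moves the projection to C by O(l), and peripheral
   subgroups are undistorted.

   Let L bound the X-lengths of a and b, let x be a conjugator of minimal
   relative length m, and let p be a relative geodesic from 1 to x.  By
   minimality, if p and its translate a p both have an edge in a coset C, they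
   have it at the same position.  If only p has one, projecting the quadrangle
   1, x, ax, a to C bounds its X-length by O(L); if both do, the conjugates of a
   by the two endpoints of the edge of p lie in a peripheral subgroup and have
   length O(L), so the edge can be replaced by a peripheral conjugator of length
   O(L^n).  Finally m = O(L): away from the ends of p, the conjugates of a by the
   vertices of p are distinct by minimality and lie in a fixed ball of X. *)

Set Implicit Arguments.
Unset Strict Implicit.
Unset Printing Implicit Defensive.

Import Order.TTheory GRing.Theory Num.Theory.

(** * Paths as sequences of vertices *)

Section Chains.
Variable G : groupType.
Implicit Types (E : G -> G -> Prop) (u v w : G) (f : nat -> G).
Local Open Scope nat_scope.

(** The relation on consecutive vertices is a parameter, so that extra conditions on edges, such as
    avoiding a coset, fit the same notion. Values of [f] beyond [n] are irrelevant. *)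
Definition chain E n u v := exists f : nat -> G,
  [/\ f 0 = u, f n = v & forall k, k < n -> E (f k) (f k.+1)].

Lemma chain0 E u : chain E 0 u u.
Proof. by exists (fun=> u). Qed.

Lemma chain1 E u v : E u v -> chain E 1 u v.
Proof. by move=> Euv; exists (fun k => if k is 0 then u else v); split=> // -[]. Qed.

Lemma chain_cat E m n u v w :
  chain E m u v -> chain E n v w -> chain E (m + n) u w.
Proof.
move=> [f [f0 fm Ef]] [g [g0 gn Eg]].
exists (fun k => if k <= m then f k else g (k - m)); split=> //.
- case: ifP => [nm|_]; last by rewrite addKn.
  by have n0 : n = 0 by [lia]; rewrite n0 addn0 fm -g0 -gn n0.
- move=> k kmn; case: (ltnP k m) => [km|mk]; first by rewrite ltnW ?km//; apply: Ef.
  case: (ltnP m k) => [mk'|km].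
    by have := Eg (k - m); rewrite -subSn//; apply; lia.
  have -> : k = m by lia.
  rewrite subSnn fm -g0; apply: Eg; lia.
Qed.

Lemma chain_sub E E' n u v : (forall a b, E a b -> E' a b) ->
  chain E n u v -> chain E' n u v.
Proof. by move=> EE' [f [f0 fn Ef]]; exists f; split=> // k /Ef /EE'. Qed.

Lemma chain_rev E n u v : (forall a b, E a b -> E b a) ->
  chain E n u v -> chain E n v u.
Proof.
move=> symE [f [f0 fn Ef]]; exists (fun k => f (n - k)).
rewrite subn0 subnn; split=> // k kn; apply: symE.
by have -> : n - k = (n - k.+1).+1 by [lia]; apply: Ef; lia.
Qed.

Lemma chain_sub_path E f a b : a <= b ->
  (forall k, a <= k < b -> E (f k) (f k.+1)) -> chain E (b - a) (f a) (f b).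
Proof.
move=> ab Ef; exists (fun k => f (a + k)); rewrite addn0 subnKC//; split=> // k kb.
by rewrite addnS; apply: Ef; lia.
Qed.

Definition cpath_of f n : cpath G :=
  CPath (f 0) [seq ((f k)^-1 * f k.+1)%g | k <- iota 0 n].

Lemma plength_cpath_of f n : plength (cpath_of f n) = n.
Proof. by rewrite /plength size_map size_iota. Qed.

Lemma nth_cpath_of f n k : k < n ->
  nth 1%g (label (cpath_of f n)) k = ((f k)^-1 * f k.+1)%g.
Proof. by move=> kn; rewrite (nth_map 0) ?size_iota// nth_iota. Qed.

Lemma vertexS (p : cpath G) k : k < plength p ->
  vertex p k.+1 = (vertex p k * nth 1 (label p) k)%g.
Proof.
by move=> kp; rewrite /vertex (take_nth 1%g)// -cats1 big_cat big_seq1 mulgA.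
Qed.

Lemma vertex_cpath_of f n k : k <= n -> vertex (cpath_of f n) k = f k.
Proof.
elim: k => [|k IH] kn; first by rewrite /vertex take0 big_nil mulg1.
by rewrite vertexS ?plength_cpath_of// nth_cpath_of// IH ?mulVKg// ltnW.
Qed.

Lemma terminus_cpath_of f n : terminus (cpath_of f n) = f n.
Proof. by rewrite /terminus plength_cpath_of vertex_cpath_of. Qed.

Lemma vertex0 (p : cpath G) : vertex p 0 = origin p.
Proof. by rewrite /vertex take0 big_nil mulg1. Qed.

Lemma vertex_step (p : cpath G) k : k < plength p ->
  ((vertex p k)^-1 * vertex p k.+1)%g = nth 1%g (label p) k.
Proof. by move=> kp; rewrite vertexS// mulKg. Qed.

End Chains.

(** * Word metric, geodesics and slim polygons *)

Section WordMetric.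
Variables (G : groupType) (S : set G).
Implicit Types (u v w : G) (f : nat -> G).
Local Open Scope nat_scope.

Definition edge u v := S (u^-1 * v)%g \/ S ((u^-1 * v)^-1)%g.

Lemma edge_sym u v : edge u v -> edge v u.
Proof. by rewrite /edge !invgM !invgK => -[]; [right|left]. Qed.

Lemma edge_mul x u v : edge u v -> edge (x * u) (x * v).
Proof. by rewrite /edge [((x * u)^-1)%g]invgM -mulgA mulKg. Qed.

Lemma is_path_edge (p : cpath G) k : is_path S p -> k < plength p ->
  edge (vertex p k) (vertex p k.+1).
Proof. by move=> pS kp; rewrite /edge vertex_step//; apply: pS; rewrite mem_nth. Qed.

Lemma is_path_cpath_of f n : (forall k, k < n -> edge (f k) (f k.+1)) ->
  is_path S (cpath_of f n).
Proof.
move=> Ef s /mapP[k]; rewrite mem_iota => /andP[_ kn] ->; exact: Ef.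
Qed.

Lemma chain_cpath n u v : (exists p, [/\ is_path S p, origin p = u,
  terminus p = v & plength p = n]) <-> chain edge n u v.
Proof.
split=> [[p [pS <- <- <-]]|[f [<- <- Ef]]].
  exists (vertex p); rewrite vertex0; split=> // k; exact: is_path_edge.
exists (cpath_of f n); rewrite terminus_cpath_of plength_cpath_of; split=> //.
exact: is_path_cpath_of.
Qed.

Local Notation dist := (cayley_dist S).

(** Once some chain joins [u] to [v], the minimum in [cayley_dist] is attained and its default value
    0 does not intervene. *)
Lemma dist_spec n u v : chain edge n u v ->
  chain edge (dist u v) u v /\ dist u v <= n.
Proof.
move=> ch; have ex : exists n, `[< chain edge n u v >] by exists n; apply/asboolP.
rewrite /cayley_dist; case: xgetP => [_ -> [lm minm]|].
  by split; [apply/chain_cpath|apply/minm/chain_cpath].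
case: (ex_minnP ex) => k /asboolP chk mink /(_ k) [].
split=> [|m /chain_cpath chm]; first exact/chain_cpath.
exact/mink/asboolP.
Qed.

Lemma dist_chain u v : (exists n, chain edge n u v) ->
  chain edge (dist u v) u v.
Proof. by move=> [n /dist_spec[]]. Qed.

Lemma dist_le n u v : chain edge n u v -> dist u v <= n.
Proof. by move=> /dist_spec[]. Qed.

Lemma chain_mul n x u v : chain edge n u v -> chain edge n (x * u)%g (x * v)%g.
Proof.
move=> [f [<- <- Ef]]; exists (fun k => x * f k)%g; split=> // k /Ef.
exact: edge_mul.
Qed.

Lemma dist0 u : dist u u = 0.
Proof. by apply/eqP; rewrite -leqn0; apply: dist_le (chain0 _ _). Qed.

Lemma dist_edge u v : edge u v -> dist u v <= 1.
Proof. by move=> /chain1/dist_le. Qed.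

Hypothesis conn : forall u v, exists n, chain edge n u v.

Lemma dist_triangle u v w : dist u w <= dist u v + dist v w.
Proof.
by apply: dist_le; apply: chain_cat (dist_chain (conn u v)) (dist_chain (conn v w)).
Qed.

Lemma dist_sym u v : dist u v = dist v u.
Proof.
by apply/eqP; rewrite eqn_leq !dist_le//; apply: chain_rev (dist_chain (conn _ _));
  apply: edge_sym.
Qed.

Lemma dist_eq0 u v : dist u v = 0 -> u = v.
Proof. by have := dist_chain (conn u v); move=> + d0; rewrite d0 => -[f [<- <-]]. Qed.

Lemma dist_eq1 u v : dist u v = 1 -> edge u v.
Proof.
have := dist_chain (conn u v); move=> + d0; rewrite d0 => -[f [<- <-]].
exact.
Qed.

Lemma dist_mul x u v : dist (x * u) (x * v) = dist u v.
Proof.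
apply/eqP; rewrite eqn_leq !dist_le//.
  rewrite -{2}(mulKg x u) -{2}(mulKg x v); apply: chain_mul.
  exact: dist_chain.
by apply: chain_mul; apply: dist_chain.
Qed.

Lemma dist_word u v : word_length S (u^-1 * v) = dist u v.
Proof. by rewrite /word_length -(dist_mul u) mulg1 mulVKg. Qed.

Definition geod f n := forall j k, j <= k <= n -> dist (f j) (f k) = k - j.

Lemma geod_edge f n k : geod f n -> k < n -> edge (f k) (f k.+1).
Proof. by move=> gf kn; apply: dist_eq1; rewrite gf ?subSnn//; lia. Qed.

Lemma geod_rev f n : geod f n -> geod (fun k => f (n - k)) n.
Proof. by move=> gf j k jk; rewrite dist_sym gf; lia. Qed.

Lemma geod_mul x f n : geod f n -> geod (fun k => x * f k)%g n.
Proof. by move=> gf j k jk; rewrite dist_mul gf. Qed.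

Lemma geod_shift a f n : geod f (a + n) -> geod (fun k => f (a + k)) n.
Proof. by move=> gf j k jk; rewrite gf; lia. Qed.

Lemma geod_prefix m f n : m <= n -> geod f n -> geod f m.
Proof. by move=> mn gf j k jk; rewrite gf; lia. Qed.

Lemma shortest_geod f n : (forall k, k < n -> edge (f k) (f k.+1)) ->
  n <= dist (f 0) (f n) -> geod f n.
Proof.
move=> Ef nd j k /andP[jk kn]; apply/eqP; rewrite eqn_leq; apply/andP; split.
  by apply/dist_le/chain_sub_path => // i ij; apply: Ef; lia.
have h a b : a <= b -> b <= n -> dist (f a) (f b) <= b - a.
  by move=> ab bn; apply/dist_le/chain_sub_path => // i ij; apply: Ef; lia.
have := dist_triangle (f 0) (f j) (f n); have := dist_triangle (f j) (f k) (f n).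
by have := h 0 j; have := h k n; lia.
Qed.

Lemma geod_exists u v : exists f, [/\ f 0 = u, f (dist u v) = v & geod f (dist u v)].
Proof.
have [f [f0 fn Ef]] := dist_chain (conn u v); exists f; split=> //.
by apply: shortest_geod; rewrite ?f0 ?fn.
Qed.

Lemma geod_geodesic f n : geod f n -> geodesic S (cpath_of f n).
Proof.
move=> gf; split; first by apply: is_path_cpath_of => k; apply: geod_edge.
by rewrite plength_cpath_of terminus_cpath_of /= gf ?subn0//; lia.
Qed.

Definition slim_triangles (d : nat) := forall f m g n h r,
  geod f m -> geod g n -> geod h r -> f m = g 0 -> g n = h r -> f 0 = h 0 ->
  forall k, k <= m ->
    (exists2 j, j <= n & dist (f k) (g j) <= d) \/
    (exists2 j, j <= r & dist (f k) (h j) <= d).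

(** Distances are integers, so [delta] can be truncated. The third side is reversed, since
    [slim_triangles] starts it at the origin of [f]. *)
Lemma hyperbolic_slim (R : realType) : hyperbolic_graph R S ->
  exists d, slim_triangles d.
Proof.
move=> [delta hyp]; exists (Num.truncn delta) => f m g n h r gf gg gh fg ghr fh k km.
have le_trunc (i : nat) : (i%:R <= delta)%R -> i <= Num.truncn delta.
  by move=> id; rewrite truncn_ge_nat// (le_trans _ id) ?ler0n.
have := hyp _ _ _ (geod_geodesic gf) (geod_geodesic gg)
  (geod_geodesic (geod_rev gh)).
rewrite !terminus_cpath_of /= subn0 subnn !plength_cpath_of => /(_ fg ghr (esym fh) k km).
rewrite vertex_cpath_of// => -[] [j jn]; rewrite vertex_cpath_of// => /le_trunc dj.
  by left; exists j.
by right; exists (r - j); [lia|].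
Qed.

(** The diagonal from [f 0] to [g n] cuts the quadrangle into two triangles, which doubles the
    constant. *)
Lemma slim_quadrangle d f m g n h r e t : slim_triangles d ->
  geod f m -> geod g n -> geod h r -> geod e t ->
  f m = g 0 -> g n = h r -> f 0 = e 0 -> h 0 = e t ->
  forall k, k <= m ->
  [\/ exists2 j, j <= n & dist (f k) (g j) <= d.*2,
      exists2 j, j <= r & dist (f k) (h j) <= d.*2 |
      exists2 j, j <= t & dist (f k) (e j) <= d.*2].
Proof.
move=> slim gf gg gh ge fg ghr fe he k km.
have [i [i0 iq gi]] := geod_exists (f 0) (g n).
have [|[j jq dj]] := slim _ _ _ _ _ _ gf gg gi fg (esym iq) (esym i0) k km.
  by move=> [j jn dj]; constructor 1; exists j => //; lia.
have hrev := geod_rev gh.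
have h1 : i (dist (f 0) (g n)) = h (r - 0) by rewrite subn0 -ghr.
have h2 : h (r - r) = e t by rewrite subnn.
have h3 : i 0 = e 0 by rewrite i0.
case: (slim _ _ _ _ _ _ gi hrev ge h1 h2 h3 j jq) => -[l lr dl].
  constructor 2; exists (r - l); first lia.
  by have := dist_triangle (f k) (i j) (h (r - l)); lia.
by constructor 3; exists l => //; have := dist_triangle (f k) (i j) (e l); lia.
Qed.

End WordMetric.

(** * Cosets of a subgroup *)

Section Cosets.
Variables (G : groupType) (K : groupClosed G).
Implicit Types g x y : G.

Lemma in_cosetP g x : in_coset K g x <-> (g^-1 * x)%g \in K.
Proof.
split=> [[h hK ->]|gx]; first by rewrite mulKg.
by exists (g^-1 * x)%g; rewrite ?mulVKg.
Qed.

Lemma in_coset_refl g : in_coset K g g.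
Proof. by apply/in_cosetP; rewrite mulVg gpred1. Qed.

Lemma in_coset_div g x y : in_coset K g x -> in_coset K g y -> (x^-1 * y)%g \in K.
Proof.
by move=> [h hK ->] [h' h'K ->]; rewrite invgM -mulgA mulKg gpredM// gpredV.
Qed.

Lemma in_coset_step g x y : in_coset K g x -> (x^-1 * y)%g \in K -> in_coset K g y.
Proof.
move=> /in_cosetP gx xy; apply/in_cosetP.
by rewrite -(mulVKg x y) mulgA gpredM.
Qed.

End Cosets.

(** * Paths without edges in a given set *)

Section Avoiding.
Variables (G : groupType) (S : set G).
Implicit Types (C : G -> Prop) (u v w : G).
Local Open Scope nat_scope.

(** For [C] a peripheral coset: a chain may pass through vertices of [C], but no edge has both ends
    in it, whatever its label. *)
Definition avoids C u v := edge S u v /\ ~ (C u /\ C v).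

Definition avoiding_chain C N u v := exists2 n, n <= N & chain (avoids C) n u v.

Lemma avoids_sym C u v : avoids C u v -> avoids C v u.
Proof. by move=> [/edge_sym euv nC]; split=> // -[? ?]; apply: nC. Qed.

Lemma avoiding_cat C N M u v w : avoiding_chain C N u v ->
  avoiding_chain C M v w -> avoiding_chain C (N + M) u w.
Proof.
move=> [n nN chn] [m mM chm]; exists (n + m); first by lia.
exact: chain_cat chn chm.
Qed.

Lemma avoiding_rev C N u v : avoiding_chain C N u v -> avoiding_chain C N v u.
Proof. by move=> [n nN ch]; exists n => //; apply: chain_rev ch; apply: avoids_sym. Qed.

Lemma avoiding_leq C N M u v : N <= M -> avoiding_chain C N u v ->
  avoiding_chain C M u v.
Proof. by move=> NM [n nN ch]; exists n => //; lia. Qed.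

Lemma avoiding_path C f a b : a <= b ->
  (forall k, a <= k < b -> avoids C (f k) (f k.+1)) ->
  avoiding_chain C (b - a) (f a) (f b).
Proof. by move=> ab Ef; exists (b - a) => //; apply: chain_sub_path. Qed.

End Avoiding.

(** * Bounded coset penetration for avoiding paths *)

Section IsolatedComponents.
Variables (R : realType) (G : groupType) (X : seq G).
Variables (I : Type) (H : I -> groupClosed G).
Hypothesis genX : generates X [set: G].
Local Open Scope nat_scope.

Local Notation S := (relative_alphabet X H).
Local Notation dX := (cayley_dist [set` X]).
Local Notation dH := (cayley_dist S).

Lemma connX u v : exists n, chain (edge [set` X]) n u v.
Proof.
have [p [pX o t]] := genX.2 (u^-1 * v)%g Logic.I; exists (plength p).
have := chain_mul u ((chain_cpath _ _ _ _).1 (ex_intro _ p (And4 pX o t erefl))).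
by rewrite mulg1 mulVKg.
Qed.

Lemma edge_relative u v : edge [set` X] u v -> edge S u v.
Proof. by case=> ?; [left|right]; left. Qed.

Lemma connH u v : exists n, chain (edge S) n u v.
Proof.
have [n ch] := connX u v; exists n; apply: chain_sub ch; exact: edge_relative.
Qed.

Lemma dH_le_dX u v : dH u v <= dX u v.
Proof.
apply: dist_le; apply: chain_sub (dist_chain (connX u v)); exact: edge_relative.
Qed.

Lemma edge_coset i u v : (u^-1 * v)%g \in H i -> edge S u v.
Proof. by move=> uv; left; right; exists i. Qed.

Lemma component_meet (K : groupClosed G) p a b a' b' :
  component K p a b -> component K p a' b' -> a' <= b -> a <= b' ->
  a' = a /\ b' = b.
Proof.
move=> [/andP[ab bp] lab mab] [/andP[ab' bp'] lab' mab'] a'b ab'2.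
have lU : labelled_in K p (minn a a') (maxn b b').
  move=> k kU; case: (boolP (a <= k < b)) => [/lab//|nab].
  by apply: lab'; lia.
have [] := mab (minn a a') (maxn b b'); [lia|lia|exact: lU|].
have [] := mab' (minn a a') (maxn b b'); [lia|lia|exact: lU|].
lia.
Qed.

Lemma labelled_coset (K : groupClosed G) f n a b k : b <= n -> a <= k <= b ->
  labelled_in K (cpath_of f n) a b -> in_coset K (f a) (f k).
Proof.
move=> bn /andP[ak kb] lab; rewrite -(subnKC ak) in kb *.
elim: (k - a) kb => [|j IH] jb; first by rewrite addn0; apply: in_coset_refl.
rewrite addnS; apply: in_coset_step (IH _) _; first lia.
by rewrite -(@nth_cpath_of _ f n); [apply: lab|]; lia.
Qed.

(* A shortest C-avoiding path does not backtrack: between two visits of a coset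
   D it could be replaced by one edge of D, or by two if that edge lies in C,
   through an element of D outside C. *)
Lemma shortest_avoiding C f n :
  (forall k, k < n -> avoids S C (f k) (f k.+1)) ->
  (forall m, chain (avoids S C) m (f 0) (f n) -> n <= m) ->
  quasi_geodesic S (n%:R : R) 0%R (cpath_of f n) /\
  without_backtracking H (cpath_of f n).
Proof.
move=> Ef minf.
have shortcut j k m : j <= k <= n -> chain (avoids S C) m (f j) (f k) -> k - j <= m.
  move=> /andP[jk kn] ch.
  have c1 : chain (avoids S C) (j - 0) (f 0) (f j).
    by apply: chain_sub_path => // i ij; apply: Ef; lia.
  have c2 : chain (avoids S C) (n - k) (f k) (f n).
    by apply: chain_sub_path => // i ij; apply: Ef; lia.
  by have := minf _ (chain_cat (chain_cat c1 ch) c2); lia.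
split.
  split; first by apply: is_path_cpath_of => k /Ef[].
  move=> j k; rewrite plength_cpath_of => /andP[jk kn].
  rewrite addr0 !vertex_cpath_of//; last exact: leq_trans kn.
  rewrite -natrM ler_nat; have [|d0] := posnP (dH (f j) (f k)); last by nia.
  move=> /(dist_eq0 connH) fjk; rewrite (leq_trans (shortcut j k 0 _ _))// ?jk//.
  by rewrite fjk; apply: chain0.
(* Here [b' - a] is at least 3, so a shortcut of one or two edges contradicts minimality. *)
have no_return i a b a' b' : a < b -> b < a' -> a' < b' -> b' <= n ->
    in_coset (H i) (f a) (f a.+1) -> in_coset (H i) (f a) (f b') -> False.
  move=> ab ba' ab' bn fa fb'.
  have fa0 := in_coset_refl (H i) (f a).
  have [CC|nCC] := pselect (C (f a) /\ C (f b')); last first.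
    have /chain1/(shortcut a b') : avoids S C (f a) (f b').
      by split=> //; apply: (edge_coset (i := i)); apply: in_coset_div fb'.
    lia.
  have nC : ~ C (f a.+1).
    by have /Ef[_ nC] : a < n by [lia]; move=> Ca; apply: nC; split=> //; case: CC.
  have c1 : avoids S C (f a) (f a.+1) by apply: Ef; lia.
  have c2 : avoids S C (f a.+1) (f b').
    split; last by case.
    by apply: (edge_coset (i := i)); apply: in_coset_div fb'.
  by have := shortcut _ _ _ _ (chain_cat (chain1 c1) (chain1 c2)); lia.
move=> i a b cab a' b' cab'; case: (cab) (cab') => [/andP[ab bn] lab _] [/andP[ab' bn'] lab' _].
rewrite plength_cpath_of in bn bn'.
move=> [h hH]; rewrite !vertex_cpath_of; try lia.
move=> fah; have faa' : in_coset (H i) (f a) (f a') by exists h.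
case: (ltnP b a') => [ba'|a'b].
  exfalso; apply: (no_return i a b a' b') => //.
    by apply: (labelled_coset bn _ lab); lia.
  apply: in_coset_step faa' (in_coset_div (in_coset_refl _ _) (labelled_coset bn' _ lab')).
  lia.
case: (ltnP b' a) => [b'a|ab'2]; last exact: component_meet cab cab' _ _.
exfalso; apply: (no_return i a' b' a b) => //.
  by apply: (labelled_coset bn' _ lab'); lia.
have fa'a : in_coset (H i) (f a') (f a).
  by apply/in_cosetP; rewrite -fah invgM -mulgA mulVg mulg1 gpredV.
apply: in_coset_step fa'a (in_coset_div (in_coset_refl _ _) (labelled_coset bn _ lab)).
lia.
Qed.

Lemma single_edge i u v N : u <> v -> (u^-1 * v)%g \in H i -> 0 < N ->
  let p := CPath u [:: u^-1 * v]%g in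
  [/\ quasi_geodesic S (N%:R : R) 0%R p, without_backtracking H p &
      penetrates_at (H i) p u 0 1].
Proof.
move=> uv uvH N0 p.
have v0 : vertex p 0 = u by rewrite vertex0.
have v1 : vertex p 1 = v by rewrite /vertex /= big_seq1 mulVKg.
split.
- split; first by move=> s; rewrite inE => /eqP->; apply: (edge_coset uvH).
  move=> j k; rewrite /plength /= => jk; rewrite addr0.
  have [<-|[-> ->]] : j = k \/ j = 0 /\ k = 1 by lia.
    by rewrite subnn mulr_ge0.
  rewrite v0 v1 -natrM ler_nat; have [/(dist_eq0 connH)//|] := posnP (dH u v).
  nia.
- have c01 j a b : component (H j) p a b -> a = 0 /\ b = 1.
    by move=> [+ _ _]; rewrite /plength /=; lia.
  by move=> j a b /c01[-> ->] a' b' /c01[].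
- split; last by rewrite v0; apply: in_coset_refl.
  split=> //; first by case.
  by move=> a' b' /=; rewrite /plength/=; lia.
Qed.

(** Clause (2) of BCP compares the single edge from [u] to [v] with a shortest avoiding chain, which
    is a quasi-geodesic without backtracking and does not penetrate the coset. *)
Lemma isolated_bound : BCP R X H -> forall N, exists c, forall i g u v,
  in_coset (H i) g u -> in_coset (H i) g v ->
  avoiding_chain S (in_coset (H i) g) N u v -> dX u v <= c.
Proof.
move=> bcp N; have [c hc] := bcp (N%:R)%R; exists (Num.truncn c) => i g u v gu gv [n nN chn].
have [->|uv] := pselect (u = v); first by rewrite dist0.
set C := in_coset (H i) g in chn *.
have ex : exists m, `[< chain (avoids S C) m u v >] by exists n; apply/asboolP.
case: (ex_minnP ex) => m /asboolP[f [f0 fm Ef]] minm.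
have mN : m <= N by rewrite (leq_trans (minm n _))//; apply/asboolP.
have [|qg nb] := shortest_avoiding Ef.
  by move=> k; rewrite f0 fm => chk; apply/minm/asboolP.
have N0 : 0 < N by case: (posnP N) => // N0; have m0 : m = 0 by [lia]; case: uv; rewrite -f0 -fm m0.
have [qg' nb' pen] := single_edge uv (in_coset_div gu gv) N0.
(* The multiplier is raised from [m] to [N], so that [c] depends on [N] only. *)
have qgN : quasi_geodesic S (N%:R : R) 0%R (cpath_of f m).
  split=> [|j k jk]; first by case: qg.
  by rewrite (le_trans (qg.2 j k jk))// !addr0 ler_wpM2r ?ler_nat.
have e1 : u = f 0 by rewrite f0.
have e2 : terminus (CPath u [:: u^-1 * v]%g) = terminus (cpath_of f m).
  by rewrite terminus_cpath_of fm /terminus /vertex/= big_seq1 mulVKg.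
have npen : ~ penetrates (H i) (cpath_of f m) u.
  move=> [a [b [[/andP[ab bp] lab _] ua]]]; rewrite plength_cpath_of in bp.
  have /Ef[_] : a < m by lia.
  rewrite vertex_cpath_of in ua; last lia.
  have ga : C (f a) by apply: in_coset_step gu _; apply/in_cosetP.
  case; split=> //; apply: in_coset_step ga _.
  by rewrite -(@nth_cpath_of _ f m); [apply: lab|]; lia.
have [_ /(_ i u 0 1 pen npen)] := hc _ _ qg' qgN nb' nb e1 e2.
rewrite vertex0 /vertex /= big_seq1 mulVKg => le_c.
by rewrite truncn_ge_nat// (le_trans _ le_c).
Qed.

End IsolatedComponents.

(** * Nearest-point projections *)

Section Projections.
Variables (G : groupType) (S : set G).
Implicit Types (C : G -> Prop) (u v y z : G) (f e : nat -> G).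
Local Open Scope nat_scope.
Local Notation dist := (cayley_dist S).
Hypothesis conn : forall u v, exists n, chain (edge S) n u v.

(** A relation, since nearest points need not be unique; the bounds below hold for every choice. *)
Definition nearest C u y := C y /\ forall z, C z -> dist u y <= dist u z.

Lemma nearest_exists C u : (exists y, C y) -> exists y, nearest C u y.
Proof.
move=> [y Cy]; have ex : exists n, `[< exists2 z, C z & dist u z = n >].
  by exists (dist u y); apply/asboolP; exists y.
case: (ex_minnP ex) => n /asboolP[z Cz <-] minn; exists z; split=> // w Cw.
by apply: minn; apply/asboolP; exists w.
Qed.

Lemma nearest_id C u y : C u -> nearest C u y -> y = u.
Proof.
move=> Cu [_ /(_ u Cu)]; rewrite dist0 leqn0 => /eqP.
by move=> /(dist_eq0 conn).
Qed.

Lemma avoiding_dist C N u v : avoiding_chain S C N u v -> dist u v <= N.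
Proof.
move=> [n nN ch]; apply: leq_trans nN; apply: dist_le.
by apply: chain_sub ch => a b [].
Qed.

Lemma far_avoiding C M u v : (forall z, C z -> M < dist u z) -> dist u v <= M ->
  avoiding_chain S C M u v.
Proof.
move=> far uv; have [f [f0 fn gf]] := geod_exists conn u v.
apply: (avoiding_leq uv); rewrite -[dist u v]subn0 -{2}f0 -{2}fn.
apply: avoiding_path => // k kn; split; first by apply: (geod_edge conn gf); lia.
move=> [/far + _]; rewrite -f0 gf; lia.
Qed.

(** The triangle inequality through [f j] keeps [f j] at least [m - j] away from [C], so the
    geodesic meets [C] only at its end. *)
Lemma to_nearest C u y f m : nearest C u y -> geod S f m -> f 0 = u -> f m = y ->
  forall j, j <= m -> (forall z, C z -> m - j <= dist (f j) z) /\
    avoiding_chain S C (m - j) (f j) y.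
Proof.
move=> [_ near] gf f0 fm.
have far j z : j <= m -> C z -> m - j <= dist (f j) z.
  move=> jm /near; rewrite -f0 -fm gf; last by lia.
  by have := dist_triangle conn (f 0) (f j) z; rewrite gf; lia.
move=> j jm; split=> [z|]; first exact: far.
rewrite -fm; apply: avoiding_path => // k /andP[jk km].
split; first exact: (geod_edge conn gf).
by move=> [Ck _]; have := far k _ (ltnW km) Ck; rewrite dist0; lia.
Qed.

(** * Projection of a geodesic to a set of diameter at most 1 *)

Section Slim.
Variables (d : nat) (C : G -> Prop).
Hypothesis slim : slim_triangles S d.
Hypothesis diamC : forall y y', C y -> C y' -> dist y y' <= 1.

Let D := d.*2.+1.

(** The point of a geodesic [[e 0, y]] at distance [D = 2d + 1] from [C] is within [2d] of another
    side of the quadrangle [e 0], [y], [y'], [e t]. The side [[y, y']] has its vertices in [C] and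
    is too far; the other two sides give the two alternatives. *)
Lemma projection_escape e t y y' : geod S e t ->
  nearest C (e 0) y -> nearest C (e t) y' ->
  avoiding_chain S C (D + d.*2).*2 y y' \/
  exists2 j, j <= t & avoiding_chain S C (D + d.*2) y (e j).
Proof.
move=> ge ny ny'.
have [f [f0 fm gf]] := geod_exists conn (e 0) y.
set m := dist (e 0) y in fm gf.
have tof := to_nearest ny gf f0 fm.
have [mD|Dm] := leqP m D.
  right; exists 0 => //; apply: avoiding_rev.
  by have [_] := tof 0 isT; rewrite f0; apply: avoiding_leq; lia.
have [g [g0 gn gg]] := geod_exists conn y y'.
have [h [h0 hr gh]] := geod_exists conn (e t) y'.
set n := dist y y' in gn gg; set r := dist (e t) y' in hr gh.
have [farf chf] := tof (m - D) (leq_subr _ _).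
have mD : m - (m - D) = D by lia.
rewrite mD in farf chf.
have far z : C z -> d.*2 < dist (f (m - D)) z by move=> /farf.
have [] := slim_quadrangle conn slim gf gg gh ge _ _ f0 h0 (leq_subr D m).
- by rewrite fm.
- by rewrite gn.
- move=> [j jn]; have n1 : n <= 1 by apply: diamC; [case: ny|case: ny'].
  have Cgj : C (g j).
    have [->|->] : j = 0 \/ j = n by lia.
      by rewrite g0; case: ny.
    by rewrite gn; case: ny'.
  by have := far _ Cgj; lia.
- move=> [j jr dj]; left.
  have [_ chh] := to_nearest ny' gh h0 hr jr.
  have rj : r - j <= D + d.*2.
    have := gh j r; rewrite hr jr leqnn => /(_ isT) <-.
    have [+ _] := to_nearest ny' gh h0 hr jr => /(_ y).
    have <- := gh j r; rewrite ?jr ?leqnn// hr => /(_ ny.1).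
    have := dist_triangle conn (h j) (f (m - D)) y.
    have := dist_sym conn (h j) (f (m - D)).
    by have := gf (m - D) m; rewrite leq_subr leqnn fm => /(_ isT); lia.
  have := avoiding_cat (avoiding_rev chf) (far_avoiding far dj).
  move=> /avoiding_cat/(_ chh); apply: avoiding_leq; lia.
- move=> [j jt dj]; right; exists j => //.
  exact: avoiding_cat (avoiding_rev chf) (far_avoiding far dj).
Qed.

(** Unless one end already gives a short chain, escaping from both ends joins [y] to some [e j] and
    [y'] to some [e (t - k)]. As [y] and [y'] are at distance at most 1, the stretch of [e] in
    between is bounded, and it avoids [C]. *)
Lemma projection_avoiding e t y y' : geod S e t ->
  (forall k, k < t -> avoids S C (e k) (e k.+1)) ->
  nearest C (e 0) y -> nearest C (e t) y' ->
  avoiding_chain S C ((D + d.*2) * 4).+1 y y'.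
Proof.
move=> ge ae ny ny'.
have gr := geod_rev conn ge.
have [|[j jt chj]] := projection_escape ge ny ny'; first by apply: avoiding_leq; lia.
have [|||[k kt chk]] := @projection_escape (fun k => e (t - k)) t y' y gr;
  rewrite ?subnn ?subn0//.
  by move=> /avoiding_rev; apply: avoiding_leq; lia.
have dej := avoiding_dist chj; have dek := avoiding_dist chk.
have yy' : dist y y' <= 1 by apply: diamC; [case: ny|case: ny'].
have djk : dist (e j) (e (t - k)) <= (D + d.*2).*2.+1.
  have := dist_triangle conn (e j) y (e (t - k)).
  have := dist_triangle conn y y' (e (t - k)).
  by have := dist_sym conn (e j) y; lia.
have chjk : avoiding_chain S C (D + d.*2).*2.+1 (e j) (e (t - k)).
  have [jk|kj] := leqP j (t - k).
    apply: (avoiding_leq djk); rewrite ge; last lia.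
    by apply: avoiding_path => // i ij; apply: ae; lia.
  apply: avoiding_rev; apply: (avoiding_leq djk).
  rewrite (dist_sym conn) ge; last lia.
  by apply: avoiding_path; [lia|] => i ij; apply: ae; lia.
have := avoiding_cat (avoiding_cat chj chjk) (avoiding_rev chk).
by apply: avoiding_leq; lia.
Qed.

End Slim.
End Projections.

(** * Undistorted peripheral subgroups and uniform CSP bounds *)

Section PeripheralBounds.
Variables (R : realType) (G : groupType) (X : seq G).
Variables (I : Type) (H : I -> groupClosed G).
Hypothesis genX : generates X [set: G].
Hypothesis hypG : relatively_hyperbolic R X H.
Local Open Scope nat_scope.

Local Notation S := (relative_alphabet X H).
Local Notation dX := (cayley_dist [set` X]).
Local Notation dH := (cayley_dist S).
Local Notation normX := (word_length [set` X]).
Let cX := connX genX.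
Let cH := connH H genX.

Lemma coset_diam i g y y' : in_coset (H i) g y -> in_coset (H i) g y' -> dH y y' <= 1.
Proof.
by move=> gy gy'; apply: dist_edge; apply: (edge_coset X (in_coset_div gy gy')).
Qed.

Lemma projection_bound : exists K, 0 < K /\ forall i g e t y y', geod S e t ->
  (forall k, k < t -> avoids S (in_coset (H i) g) (e k) (e k.+1)) ->
  nearest S (in_coset (H i) g) (e 0) y -> nearest S (in_coset (H i) g) (e t) y' ->
  dX y y' <= K.
Proof.
have [d slim] := hyperbolic_slim cH hypG.1.
have [c hc] := isolated_bound genX hypG.2 ((d.*2.+1 + d.*2) * 4).+1.
(* The successor makes the bound positive, as needed for X-edges inside the coset. *)
exists c.+1; split=> // i g e t y y' ge ae ny ny'; apply/leqW/(hc i g).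
- by case: ny.
- by case: ny'.
- by apply: (projection_avoiding cH slim (@coset_diam i g) ge ae).
Qed.

Definition short_step (C : G -> Prop) K u v := [/\ C u, C v & dX u v <= K].

(** Endpoints of an X-edge inside the coset are their own projections; those of any other X-edge are
    joined by a relative geodesic of length at most 1 avoiding the coset. Even for [n = 0] there may
    be two nearest points, whence [n.+1]. *)
Lemma projection_chain : exists K, forall i g n u v y y',
  chain (edge [set` X]) n u v ->
  nearest S (in_coset (H i) g) u y -> nearest S (in_coset (H i) g) v y' ->
  chain (short_step (in_coset (H i) g) K) n.+1 y y'.
Proof.
have [K [K0 hK]] := projection_bound; exists K => i g.
set C := in_coset (H i) g.
have step u v y y' : (u = v \/ edge [set` X] u v) ->
    nearest S C u y -> nearest S C v y' -> short_step C K y y'.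
  move=> uv ny ny'; split; [by case: ny|by case: ny'|].
  have [[Cu Cv]|nC] := pselect (C u /\ C v).
    rewrite (nearest_id cH Cu ny) (nearest_id cH Cv ny').
    by case: uv => [->|/dist_edge uv]; [rewrite dist0|apply: leq_trans uv _].
  have uv1 : dH u v <= 1.
    case: uv => [->|uv]; first by rewrite dist0.
    by apply: dist_edge; apply: edge_relative.
  have [e [e0 et ge]] := geod_exists cH u v.
  apply: (hK i g e (dH u v)) => //; rewrite ?e0 ?et// => k kt.
  split; first exact: (geod_edge cH ge).
  have k0 : k = 0 by lia.
  have d1 : dH u v = 1 by lia.
  by rewrite k0 -[1]d1 e0 et.
elim=> [|n IH] u v y y'.
  move=> [f [<- <- _]] ny ny'; apply: chain1; apply: step ny ny'; by left.
move=> [f [<- <- Ef]] ny ny'.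
have [w nw] := nearest_exists S (f 1) (ex_intro C g (in_coset_refl _ _)).
rewrite -[n.+2]add1n; apply: chain_cat (IH (f 1) (f n.+1) w y' _ nw ny').
  by apply/chain1/(step _ _ _ _ _ ny nw); right; apply: Ef.
by have := @chain_sub_path _ (edge [set` X]) f 1 n.+1 isT; rewrite subn1; apply => k ?;
  apply: Ef; lia.
Qed.

Lemma chain_bound E N n (u v : G) : (forall a b, E a b -> dX a b <= N) ->
  chain E n u v -> dX u v <= N * n.
Proof.
move=> EN [f [<- <- Ef]]; elim: n Ef => [|n IH] Ef; first by rewrite dist0.
have := dist_triangle cX (f 0) (f n) (f n.+1).
have := EN _ _ (Ef n (ltnSn n)); have : dX (f 0) (f n) <= N * n.
  by apply: IH => k kn; apply: Ef; lia.
by rewrite mulnS; lia.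
Qed.

Lemma chain_refine E E' N n (u v : G) :
  (forall a b, E a b -> exists2 m, m <= N & chain E' m a b) ->
  chain E n u v -> exists2 m, m <= N * n & chain E' m u v.
Proof.
move=> EE' [f [<- <- Ef]]; elim: n Ef => [|n IH] Ef.
  by exists 0 => //; apply: chain0.
have [|m mn ch] := IH; first by move=> k kn; apply: Ef; lia.
have [l lN chl] := EE' _ _ (Ef n (ltnSn n)).
by exists (m + l); [rewrite mulnS; lia|apply: chain_cat ch chl].
Qed.

Lemma chain_inv (P : G -> Prop) E n u v : (forall a b, P a -> E a b -> P b) ->
  chain E n u v -> P u -> P v.
Proof.
move=> PE [f [<- <- Ef]] P0; elim: n Ef => [//|n IH] Ef.
by apply: PE (Ef n _) => //; apply: IH => k kn; apply: Ef; lia.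
Qed.

Lemma projection_lipschitz : exists K, forall i g u v y y',
  nearest S (in_coset (H i) g) u y -> nearest S (in_coset (H i) g) v y' ->
  dX y y' <= K * (dX u v).+1.
Proof.
have [K hK] := projection_chain; exists K => i g u v y y' ny ny'.
apply: chain_bound (hK _ _ _ _ _ _ _ (dist_chain (cX u v)) ny ny').
by move=> a b [].
Qed.

(** Points of [H i] are their own projections. Projecting an X-geodesic from 1 to [h] shows that
    [H i] is generated by its elements of X-length at most [K] and is undistorted. *)
Lemma peripheral_chain : exists K, forall i h, h \in H i ->
  chain (short_step (in_coset (H i) 1%g) K) (normX h).+1 1%g h.
Proof.
have [K hK] := projection_chain; exists K => i h hH.
have near x : x \in H i -> nearest S (in_coset (H i) 1%g) x x.
  move=> xH; split; first by apply/in_cosetP; rewrite invg1 mul1g.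
  by move=> z _; rewrite dist0.
apply: hK (dist_chain (cX 1%g h)) (near _ _) (near _ _) => //.
exact: gpred1.
Qed.

Lemma normX1 : normX 1%g = 0.
Proof. exact: dist0. Qed.

Lemma normXV g : normX g^-1%g = normX g.
Proof. by rewrite /word_length (dist_sym cX) -(dist_mul cX g) mulgV mulg1. Qed.

Lemma normXM g h : normX (g * h)%g <= normX g + normX h.
Proof.
have := dist_triangle cX 1%g g (g * h)%g.
by have := dist_mul cX g 1%g h; rewrite mulg1 => ->.
Qed.

Fixpoint ball r := if r is r'.+1 then
  ball r' ++ [seq (g * s)%g | g <- ball r', s <- X ++ [seq x^-1 | x <- X]%g]
  else [:: 1%g].

Lemma mem_ball r g : normX g <= r -> g \in ball r.
Proof.
elim: r g => [|r IH] g gr.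
  have /(dist_eq0 cX) <- : dX 1%g g = 0 by move: gr; rewrite /word_length; lia.
  by rewrite inE.
have [/IH gb|rg] := leqP (normX g) r; first by rewrite /= mem_cat gb.
have e : normX g = r.+1 by lia.
have [f [f0 fn gf]] := geod_exists cX 1%g g.
rewrite [dX _ _]e in fn gf.
have fr : f r \in ball r by apply: IH; rewrite /word_length -f0 gf ?subn0//; lia.
have := geod_edge cX gf (ltnSn r); rewrite fn /edge => es.
rewrite /= mem_cat; apply/orP; right; apply/allpairsP.
exists (f r, (f r)^-1 * g)%g => /=; rewrite mulVKg fr; split=> //.
rewrite mem_cat; case: es => [->//|es]; apply/orP; right.
by apply/mapP; exists ((f r)^-1 * g)^-1%g => //; rewrite invgK.
Qed.

(** Lengths are measured by [X], not by generators of [H i]; the successor absorbs terms of lower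
    degree. *)
Definition polynomial_csp n M i := forall a b, a \in H i -> b \in H i ->
  (exists2 x, x \in H i & (a ^ x)%g = b) ->
  exists x, [/\ x \in H i, (a ^ x)%g = b &
    normX x <= M * (maxn (normX a) (normX b)).+1 ^ n].

Lemma leq_expn m n k : m <= n -> m ^ k <= n ^ k.
Proof. by case: k => // k mn; rewrite leq_exp2r. Qed.

(** For [i <= n] one has [t ^ i <= (t + 1) ^ n], so the sum of the absolute values of the
    coefficients, rounded up, will do. *)
Lemma poly_growth (P : {poly R}) n : size P = n.+1 ->
  exists A, forall t : nat, (P.[t%:R] <= (A * t.+1 ^ n)%:R)%R.
Proof.
move=> sP; exists (Num.truncn (\sum_(i < size P) `|P`_i|)%R).+1 => t.
rewrite horner_coef natrM natrX.
apply: (@le_trans _ _ (\sum_(i < size P) `|P`_i| * t.+1%:R ^+ n)%R); last first.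
  by rewrite -mulr_suml ler_wpM2r ?exprn_ge0// ltW// truncnS_gt.
apply: ler_sum => -[i]; rewrite sP /= => iS _.
apply: (@le_trans _ _ (`|P`_i| * t%:R ^+ i)%R).
  by rewrite ler_wpM2r ?exprn_ge0// ler_norm.
rewrite ler_wpM2l// -!natrX ler_nat.
by rewrite (leq_trans (leq_expn _ (leqnSn t)))// leq_pexp2l.
Qed.

Lemma polynomial_csp_exists (Y : I -> seq G) n (P : {poly R}) i :
  generates (Y i) [set x | x \in H i] -> size P = n.+1 ->
  CSP_bounded [set x | x \in H i] (Y i) (fun t : R => P.[t]%R) ->
  exists M, polynomial_csp n M i.
Proof.
move=> [YH genY] sP csp; have [A hA] := poly_growth sP.
have [K hK] := peripheral_chain.
have connY h : h \in H i -> exists m, chain (edge [set` Y i]) m 1%g h.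
  move=> /genY[p [pY o t]]; exists (plength p); apply/chain_cpath.
  by exists p.
pose normY := word_length [set` Y i].
(* Each step of [peripheral_chain] is an element of [H i] in the ball of radius [K], hence has
   [Y i]-length at most [M1]. *)
pose M1 := \max_(s <- ball K | s \in H i) normY s.
have Ybound h : h \in H i -> normY h <= M1 * (normX h).+1.
  move=> hH; have [|m mM ch] := @chain_refine _ (edge [set` Y i]) M1 _ _ _ _ (hK i h hH).
    move=> a b [Ca Cb ab]; have abH := in_coset_div Ca Cb.
    exists (normY (a^-1 * b)%g).
      apply: leq_bigmax_seq => //; apply: mem_ball.
      by rewrite /word_length -(dist_mul cX a) mulg1 mulVKg.
    have := chain_mul a (dist_chain (connY _ abH)).
    by rewrite mulg1 mulVKg.
  exact: leq_trans (dist_le ch) mM.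
pose M2 := \max_(s <- Y i) normX s.
have Xbound h : h \in H i -> normX h <= M2 * normY h.
  move=> hH; apply: chain_bound (dist_chain (connY h hH)) => a b ab.
  rewrite -(dist_word cX); case: ab => ab.
    exact: (@leq_bigmax_seq _ _ xpredT normX).
  by rewrite -normXV; apply: (@leq_bigmax_seq _ _ xpredT normX).
exists (M2 * (A * M1.+1 ^ n)) => a b aH bH cab.
have [x [xH ax xP]] := csp a b aH bH cab; exists x; split=> //.
apply: leq_trans (Xbound x xH) _; rewrite -!mulnA leq_mul2l; apply/orP; right.
have := le_trans xP (hA _); rewrite ler_nat => /leq_trans; apply.
rewrite leq_mul2l -expnMn; apply/orP; right.
apply: leq_expn; have := Ybound a aH; have := Ybound b bH; rewrite -!/(normY _).
nia.
Qed.

(* H i is generated by its elements in a fixed ball of X, so there are only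
   finitely many subgroups H i, although I may be infinite. *)
Lemma polynomial_csp_uniform n : (forall i, exists M, polynomial_csp n M i) ->
  exists M, forall i, polynomial_csp n M i.
Proof.
move=> /choice[M hM]; have [K hK] := peripheral_chain.
(* [T i] records which elements of the ball lie in [H i], and this determines [H i]. *)
pose T i : {ffun 'I_(size (ball K)) -> bool} := [ffun k : 'I_(size (ball K)) => nth 1%g (ball K) k \in H i].
have subH i j : T i = T j -> forall h, h \in H i -> h \in H j.
  move=> Tij h hH; refine (@chain_inv (fun x => x \in H j) _ _ _ _ _ (hK i h hH) _); last exact: gpred1.
  move=> a b aH [Ca Cb ab]; have abH := in_coset_div Ca Cb.
  have sB : (a^-1 * b)%g \in ball K by apply: mem_ball; rewrite (dist_word cX).
  rewrite -(mulVKg a b) gpredM//.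
  have := sB; rewrite -index_mem => kB.
  by have /ffunP/(_ (Ordinal kB)) := Tij; rewrite !ffunE /= nth_index// abH => <-.
(* One index is chosen for each pattern that occurs; its constant serves every subgroup with that
   pattern. *)
pose rep (t : {ffun 'I_(size (ball K)) -> bool}) := if pselect (exists i, T i = t) is left e then M (sval (cid e)) else 0.
exists (\max_t rep t) => i a b aH bH [x xH ax].
have := @leq_bigmax _ rep (T i); rewrite {1}/rep;  case: pselect => [e|[]]; last by exists i.
case: (cid e) => j Tj /= Mj.
have ij := subH _ _ (esym Tj); have ji := subH _ _ Tj.
have [|y [yH ay yM]] := hM j a b (ij _ aH) (ij _ bH); first by exists x => //; apply: ij.
exists y; split=> //; first exact: ji.
by apply: leq_trans yM _; rewrite leq_mul2r Mj orbT.
Qed.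

End PeripheralBounds.

(** * Relative geodesics crossing a peripheral coset *)

Section Conjugators.
Variables (R : realType) (G : groupType) (X : seq G).
Variables (I : Type) (H : I -> groupClosed G).
Hypothesis genX : generates X [set: G].
Hypothesis hypG : relatively_hyperbolic R X H.
Local Open Scope nat_scope.

Local Notation S := (relative_alphabet X H).
Local Notation dX := (cayley_dist [set` X]).
Local Notation dH := (cayley_dist S).
Local Notation normX := (word_length [set` X]).
Let cX := connX genX.
Let cH := connH H genX.

Lemma edge_short_or_peripheral u v : edge S u v ->
  dX u v <= 1 \/ exists i, in_coset (H i) u u /\ in_coset (H i) u v.
Proof.
case=> -[e|[i _ e]].
- by left; apply: dist_edge; left.
- right; exists i; split; first exact: in_coset_refl.
  exact: in_coset_step (in_coset_refl _ _) e.
- by left; apply: dist_edge; right.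
- right; exists i; split; first exact: in_coset_refl.
  by apply: in_coset_step (in_coset_refl _ _) _; rewrite -gpredV.
Qed.

Lemma geod_coset_edge i g f n k l : geod S f n -> k < n -> l < n ->
  in_coset (H i) g (f k) -> in_coset (H i) g (f k.+1) ->
  in_coset (H i) g (f l) -> in_coset (H i) g (f l.+1) -> k = l.
Proof.
move=> gf kn ln fk fk1 fl fl1.
have [kl|lk|//] := ltngtP k l.
  by have := coset_diam X fk fl1; rewrite gf; lia.
by have := coset_diam X fl fk1; rewrite gf; lia.
Qed.

Lemma geod_avoids i g f n k : geod S f n -> k < n ->
  in_coset (H i) g (f k) -> in_coset (H i) g (f k.+1) ->
  forall l, l < n -> l != k -> avoids S (in_coset (H i) g) (f l) (f l.+1).
Proof.
move=> gf kn fk fk1 l ln /eqP lk; split; first exact: (geod_edge cH gf).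
by move=> [fl fl1]; apply: lk; apply: geod_coset_edge gf ln kn fl fl1 fk fk1.
Qed.

Lemma nearest_self (C : G -> Prop) u : C u -> nearest S C u u.
Proof. by move=> Cu; split=> // z _; rewrite dist0. Qed.

(** A geodesic has at most one edge in the coset: the parts before and after it avoid the coset, and
    the ends of the edge are their own projections. *)
Lemma entry_exit_bound : exists K, forall i g f n,
  geod S f n -> forall y y',
  nearest S (in_coset (H i) g) (f 0) y -> nearest S (in_coset (H i) g) (f n) y' ->
  (forall k, k < n -> in_coset (H i) g (f k) -> in_coset (H i) g (f k.+1) ->
    dX y (f k) <= K /\ dX (f k.+1) y' <= K) /\
  ((forall k, k < n -> ~ (in_coset (H i) g (f k) /\ in_coset (H i) g (f k.+1))) ->
    dX y y' <= K).
Proof.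
have [K [_ hK]] := projection_bound genX hypG; exists K => i g f n gf y y' ny ny'.
split=> [k kn fk fk1|av]; last first.
  apply: (hK i g f n) => // k kn.
  by split; [exact: (geod_edge cH gf)|exact: av].
have avf := geod_avoids gf kn fk fk1; split.
  apply: (hK i g f k) => //; last exact: nearest_self.
    by apply: geod_prefix gf; apply: ltnW.
  by move=> l lk; apply: avf; lia.
have ge : geod S (fun l => f (k.+1 + l)) (n - k.+1).
  by apply: geod_shift; rewrite subnKC.
apply: (hK i g _ _ _ _ ge) => /=.
- by move=> l ln; rewrite addnS; apply: avf; lia.
- by rewrite addn0; apply: nearest_self.
- by rewrite subnKC.
Qed.

(** * Conjugators of minimal relative length *)

Section ShortestConjugator.
Variables (a b x : G) (p : nat -> G) (m : nat).
Hypotheses (ax : (a ^ x)%g = b) (p0 : p 0 = 1%g) (pm : p m = x) (gp : geod S p m).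
Hypothesis min : forall y, (a ^ y)%g = b -> m <= dH 1%g y.

Let gap : geod S (fun k => a * p k)%g m.
Proof. exact: geod_mul. Qed.

Let axb : (a * x = x * b)%g.
Proof. by rewrite -ax conjgE mulVKg. Qed.

(** Both [a * x] and [a^-1 * x] conjugate [a] to [b], so [a * x] is at distance at least [m] from 1,
    and [x] from [a]. Hence crossing between [p] and its translate at [p j] and [a * p k] saves
    nothing in either direction. *)
Lemma translate_shift j k : j <= m -> k <= m ->
  j <= k + dH (p j) (a * p k)%g /\ k <= j + dH (p j) (a * p k)%g.
Proof.
move=> jm km; set e := dH (p j) _.
have dj : dH 1%g (p j) = j by rewrite -p0 gp ?subn0.
have djm : dH (p j) x = m - j by rewrite -pm gp ?jm ?leqnn.
have dk : dH a (a * p k)%g = k by rewrite -{1}[a]mulg1 -p0 (gap (j := 0)) ?subn0.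
have dkm : dH (a * p k)%g (a * x)%g = m - k by rewrite -pm gap ?km ?leqnn.
have m1 : m <= dH 1%g (a * x)%g by apply: min; rewrite conjgM [(a ^ a)%g]conjgE mulKg.
have m2 : m <= dH 1%g (a^-1 * x)%g.
  by apply: min; rewrite conjgM [(a ^ _)%g]conjgE invgK mulgV mulg1.
have := dist_mul cH a 1%g (a^-1 * x)%g; rewrite mulg1 mulVKg => eax.
have := dist_triangle cH 1%g (p j) (a * x)%g.
have := dist_triangle cH (p j) (a * p k)%g (a * x)%g.
have := dist_triangle cH a (a * p k)%g x.
have := dist_triangle cH (a * p k)%g (p j) x.
rewrite (dist_sym cH (a * p k)%g (p j)) -/e; lia.
Qed.

(** The start of each edge is within 1 of the end of the other, so [translate_shift] bounds each
    index by the other. *)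
Lemma translate_coset_edge i g k l : k < m -> l < m ->
  in_coset (H i) g (p k) -> in_coset (H i) g (p k.+1) ->
  in_coset (H i) g (a * p l)%g -> in_coset (H i) g (a * p l.+1)%g -> k = l.
Proof.
move=> km lm pk pk1 pl pl1.
have [_] := translate_shift (ltnW km) lm; have := coset_diam X pk pl1.
have [+ _] := translate_shift km (ltnW lm); have := coset_diam X pk1 pl.
lia.
Qed.

(** Otherwise the stretch of [p] between [j] and [k] could be cut out, giving a shorter
    conjugator. *)
Lemma conjugates_distinct j k : j < k -> k <= m -> (a ^ p j)%g <> (a ^ p k)%g.
Proof.
move=> jk km ajk; pose y := (p j * ((p k)^-1 * x))%g.
have ay : (a ^ y)%g = b by rewrite /y !conjgM ajk conjgK.
have := min ay; have := dist_triangle cH 1%g (p j) y.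
have -> : dH 1%g (p j) = j by rewrite -p0 gp ?subn0//; lia.
have -> : dH (p j) y = m - k; last by lia.
have := dist_mul cH (p j) 1%g ((p k)^-1 * x)%g; rewrite mulg1 -/y => ->.
have := dist_mul cH (p k) 1%g ((p k)^-1 * x)%g; rewrite mulg1 mulVKg => <-.
by rewrite -pm gp ?km ?leqnn.
Qed.

Let L := maxn (normX a) (normX b).

(** The point [p k] is too far from the two sides of length at most [L], so it is within [2d] of
    some [a * p j], and [j] differs from [k] by at most [2d]. *)
Lemma translate_close d k : slim_triangles S d ->
  L + d.*2 < k -> k + L + d.*2 < m -> dH (p k) (a * p k)%g <= d.*2.*2.
Proof.
move=> slim Lk km.
have [e [e0 et ge]] := geod_exists cH 1%g a; set t := dH 1%g a in et ge.
have [g [g0 gn gg]] := geod_exists cH x (a * x)%g; set n := dH x _ in gn gg.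
have tL : t <= L by apply: leq_trans (dH_le_dX H genX _ _) (leq_maxl _ _).
have nL : n <= L.
  apply: leq_trans (dH_le_dX H genX _ _) _.
  by rewrite -(dist_word cX) axb mulKg leq_maxr.
have h1 : p m = g 0 by rewrite pm.
have h2 : g n = (a * p m)%g by rewrite gn pm.
have h3 : p 0 = e 0 by rewrite p0.
have h4 : (a * p 0)%g = e t by rewrite p0 mulg1.
have km' : k <= m by lia.
have [] := slim_quadrangle cH slim gp gg gap ge h1 h2 h3 h4 km'.
- move=> [j jn dj].
  have := dist_triangle cH (p k) (g j) (p m).
  have -> : dH (p k) (p m) = m - k by rewrite gp ?km' ?leqnn.
  by rewrite h1 (dist_sym cH (g j)) gg; lia.
- move=> [j jm dj]; have := translate_shift km' jm => -[s1 s2].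
  have := dist_triangle cH (p k) (a * p j)%g (a * p k)%g.
  have [jk|kj] := leqP j k; first by rewrite gap; lia.
  by rewrite (dist_sym cH (a * p j)%g) gap; lia.
- move=> [j jt dj].
  have := dist_triangle cH (e 0) (e j) (p k).
  rewrite ge ?jt// (dist_sym cH (e j)) -h3 gp; lia.
Qed.

(* If the translate a p(l) has an edge in a coset met by p, it lies at the same
   position, so a given coset is avoided by both on one side of k. *)
Lemma one_side_avoids i g t k : t <= k -> k + t <= m ->
  exists2 k', k' <= m /\ (k' = k + t \/ k' = k - t) &
    avoiding_chain S (in_coset (H i) g) t (p k) (p k') /\
    avoiding_chain S (in_coset (H i) g) t (a * p k)%g (a * p k')%g.
Proof.
move=> tk ktm; set C := in_coset (H i) g.
pose bad l := C (p l) /\ C (p l.+1) \/ C (a * p l)%g /\ C (a * p l.+1)%g.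
have bad_uniq l1 l2 : l1 < m -> l2 < m -> bad l1 -> bad l2 -> l1 = l2.
  move=> l1m l2m [] [c1 c2] [] [c3 c4].
  - exact: geod_coset_edge gp l1m l2m c1 c2 c3 c4.
  - exact: translate_coset_edge l1m l2m c1 c2 c3 c4.
  - by apply/esym; apply: translate_coset_edge l2m l1m c3 c4 c1 c2.
  - exact: geod_coset_edge gap l1m l2m c1 c2 c3 c4.
have avp l : l < m -> ~ bad l -> avoids S C (p l) (p l.+1).
  by move=> lm nb; split; [exact: (geod_edge cH gp)|move=> c; apply: nb; left].
have avap l : l < m -> ~ bad l -> avoids S C (a * p l)%g (a * p l.+1)%g.
  by move=> lm nb; split; [exact: (geod_edge cH gap)|move=> c; apply: nb; right].
have [[l [kl lk] bl]|nbad] := pselect (exists2 l, k <= l /\ l < k + t & bad l).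
  have nb j : k - t <= j < k -> ~ bad j.
    by move=> jk bj; have e : l = j by [apply: bad_uniq => //; lia]; lia.
  exists (k - t); first by split; [lia|right].
  have kt : k - (k - t) <= t by lia.
  split; apply: avoiding_rev; apply: avoiding_leq kt _.
    by apply: avoiding_path => [|j jk]; [lia|apply: avp (nb j _)]; lia.
  apply: (avoiding_path (f := fun j => a * p j)%g) => [|j jk]; first lia.
  by apply: avap (nb j _); lia.
have nb j : k <= j < k + t -> ~ bad j.
  by move=> /andP[kj jk] bj; apply: nbad; exists j.
exists (k + t); first by split; [lia|left].
rewrite -{1 3}(addKn k t); split.
  by apply: avoiding_path => [|j jk]; [lia|apply: avp (nb j _)]; lia.
apply: (avoiding_path (f := fun j => a * p j)%g) => [|j jk]; first lia.
by apply: avap (nb j _); lia.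
Qed.

(** An edge in a coset on a geodesic [w] from [p k] to [a * p k] is bypassed: back along [w], [t]
    steps along [p], across to the translate, back, and along [w] again. The choice of [t] puts
    [p k'] farther than [4d] from the coset, so the crossing there, of length at most [4d], avoids
    it. *)
Lemma conjugate_short d c k (t := (d * 8).+2) : slim_triangles S d ->
  (forall i g u v, in_coset (H i) g u -> in_coset (H i) g v ->
    avoiding_chain S (in_coset (H i) g) (d * 12 + t * 2) u v -> dX u v <= c) ->
  L + t + d * 2 < k -> k + (L + t + d * 2) < m ->
  normX (a ^ p k)%g <= c.+1 * (d * 4).
Proof.
move=> slim iso Lk km.
have -> : (a ^ p k)%g = ((p k)^-1 * (a * p k))%g by [].
rewrite (dist_word cX).
have close := translate_close slim.
have [w [w0 wr gw]] := geod_exists cH (p k) (a * p k)%g; set r := dH (p k) _ in wr gw.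
have rd : r <= d * 4 by have := close k; rewrite -/r; lia.
suff step j : j < r -> dX (w j) (w j.+1) <= c.+1.
  apply: leq_trans (_ : c.+1 * r <= _); last by rewrite leq_mul2l rd orbT.
  apply: (chain_bound genX (E := fun u v => dX u v <= c.+1)) => //.
  by exists w; split.
move=> jr; have [|[i [Cj Cj1]]] := edge_short_or_peripheral (geod_edge cH gw jr); first by lia.
apply: leqW; apply: (iso i (w j)) => //; set C := in_coset (H i) (w j).
have avw := geod_avoids gw jr Cj Cj1.
have [||k' [k'm k'k] [avp avap]] := @one_side_avoids i (w j) t k; try lia.
rewrite -/C in avp avap.
have dkk' : dH (p k) (p k') = t.
  by case: k'k => ->; [rewrite gp|rewrite (dist_sym cH) gp]; lia.
have far z : C z -> d * 4 < dH (p k') z.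
  move=> Cz; have := coset_diam X Cj Cz.
  have := dist_triangle cH (p k) (w j) (p k').
  have := dist_triangle cH (w j) z (p k').
  by rewrite dkk' (dist_sym cH z) -w0 gw; lia.
have top : avoiding_chain S C (d * 4) (p k') (a * p k')%g.
  by apply: far_avoiding far _ => //; have := close k'; lia.
have left : avoiding_chain S C (d * 4) (w j) (p k).
  apply: avoiding_rev; rewrite -w0.
  have j4 : j - 0 <= d * 4 by lia.
  by apply: avoiding_leq j4 _; apply: avoiding_path => // l lj; apply: avw; lia.
have right : avoiding_chain S C (d * 4) (a * p k)%g (w j.+1).
  apply: avoiding_rev; rewrite -wr.
  have j4 : r - j.+1 <= d * 4 by lia.
  by apply: avoiding_leq j4 _; apply: avoiding_path => // l lj; apply: avw; lia.
have := avoiding_cat (avoiding_cat (avoiding_cat (avoiding_cat left avp) top)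
  (avoiding_rev avap)) right.
by apply: avoiding_leq; lia.
Qed.

(** The conjugates of [a] by the vertices of [p] farther than [T] from both ends are distinct and
    lie in a ball independent of [a] and [b]. *)
Lemma conjugator_length d c (t := (d * 8).+2) : slim_triangles S d ->
  (forall i g u v, in_coset (H i) g u -> in_coset (H i) g v ->
    avoiding_chain S (in_coset (H i) g) (d * 12 + t * 2) u v -> dX u v <= c) ->
  m <= (L + t + d * 2).+1 * 2 + size (ball X (c.+1 * (d * 4))).
Proof.
move=> slim iso; set T := L + t + d * 2.
have [|Tm] := leqP m (T.+1 * 2); first by lia.
pose s := [seq (a ^ p k)%g | k <- iota T.+1 (m - T.+1 * 2)].
have us : uniq s.
  rewrite map_inj_in_uniq ?iota_uniq// => j k; rewrite !mem_iota => jm km e.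
  have [jk|kj|//] := ltngtP j k.
    by case: (conjugates_distinct jk _ e); lia.
  by case: (conjugates_distinct kj _ (esym e)); lia.
have /(uniq_leq_size us) : {subset s <= ball X (c.+1 * (d * 4))}.
  move=> y /mapP[k]; rewrite mem_iota => km ->; apply: (mem_ball genX).
  by apply: conjugate_short slim iso _ _; rewrite -/t -/T; lia.
by rewrite size_map size_iota leq_subLR.
Qed.

(** One edge of [p] is traded for an element of controlled X-length. The first two hypotheses fix
    the constants of [entry_exit_bound] and [projection_lipschitz]. *)
Lemma conjugator_step K K' M n k :
  (forall i g f n, geod S f n -> forall y y',
    nearest S (in_coset (H i) g) (f 0) y -> nearest S (in_coset (H i) g) (f n) y' ->
    (forall k, k < n -> in_coset (H i) g (f k) -> in_coset (H i) g (f k.+1) ->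
      dX y (f k) <= K /\ dX (f k.+1) y' <= K) /\
    ((forall k, k < n -> ~ (in_coset (H i) g (f k) /\ in_coset (H i) g (f k.+1))) ->
      dX y y' <= K)) ->
  (forall i g u v y y', nearest S (in_coset (H i) g) u y ->
    nearest S (in_coset (H i) g) v y' -> dX y y' <= K' * (dX u v).+1) ->
  (forall i, polynomial_csp X H n M i) -> k < m ->
  exists2 s, ((a ^ p k) ^ s = a ^ p k.+1)%g &
    normX s <= M * (K * 2 + K' * L.+1).+1 ^ n + (K * 3 + K' * L.+1 * 2).+1.
Proof.
move=> hK hK' csp km; pose s := ((p k)^-1 * p k.+1)%g.
have as_ : ((a ^ p k) ^ s = a ^ p k.+1)%g by rewrite -conjgM mulVKg.
have [ds|[i [Ck Ck1]]] := edge_short_or_peripheral (geod_edge cH gp km).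
  by exists s; rewrite ?(dist_word cX)//; lia.
set C := in_coset (H i) (p k) in Ck Ck1.
have near z : exists y, nearest S C z y by apply: nearest_exists; exists (p k).
(* The corners 1, [x], [a], [a * x] are projected to the coset. *)
have [y0 n0] := near (p 0); have [ym nm] := near (p m).
have [z0 l0] := near (a * p 0)%g; have [zm lm] := near (a * p m)%g.
have [hp _] := hK i _ _ _ gp _ _ n0 nm.
have [ha ha'] := hK i _ _ _ gap _ _ l0 lm.
have [e1 e2] := hp k km Ck Ck1.
have yz0 : dX y0 z0 <= K' * L.+1.
  apply: leq_trans (hK' _ _ _ _ _ _ n0 l0) _; rewrite leq_mul2l ltnS p0 mulg1.
  by rewrite leq_maxl orbT.
have yzm : dX ym zm <= K' * L.+1.
  apply: leq_trans (hK' _ _ _ _ _ _ nm lm) _; rewrite leq_mul2l ltnS pm axb.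
  by rewrite -(dist_word cX) mulKg leq_maxr orbT.
have [[l [lm' [Al Al1]]]|nC] := pselect (exists l, l < m /\
    (C (a * p l)%g /\ C (a * p l.+1)%g)); last first.
  (* If the translate has no edge in the coset, the edge of [p] is compared with the route [y0],
     [z0], [zm], [ym]. *)
  have yz : dX z0 zm <= K by apply: ha' => l lm' Al; apply: nC; exists l.
  exists s => //; rewrite (dist_word cX).
  have := dist_triangle cX (p k) y0 (p k.+1).
  have := dist_triangle cX y0 z0 (p k.+1).
  have := dist_triangle cX z0 zm (p k.+1).
  have := dist_triangle cX zm ym (p k.+1).
  by rewrite (dist_sym cX (p k) y0) (dist_sym cX zm ym) (dist_sym cX ym (p k.+1)); lia.
(* Otherwise the two edges have the same position, the conjugates of [a] at both ends lie in [H i]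
   and are short, and the CSP bound of [H i] applies. *)
have ekl := translate_coset_edge km lm' Ck Ck1 Al Al1.
rewrite -{}ekl {l lm'} in Al Al1.
have [f1 f2] := ha k km Al Al1.
have akH : (a ^ p k)%g \in H i by exact: in_coset_div Ck Al.
have ak1H : (a ^ p k.+1)%g \in H i by exact: in_coset_div Ck1 Al1.
have [|s' [_ as' s'M]] := csp i _ _ akH ak1H.
  by exists s => //; apply: in_coset_div Ck Ck1.
exists s' => //; apply: leq_trans s'M _; apply: leq_trans (leq_addr _ _).
rewrite leq_mul2l; apply/orP; right; apply: leq_expn; rewrite ltnS geq_max.
have nE q : normX (a ^ p q)%g = dX (p q) (a * p q)%g by rewrite -(dist_word cX).
rewrite !nE; apply/andP; split.
  have := dist_triangle cX (p k) y0 (a * p k)%g.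
  have := dist_triangle cX y0 z0 (a * p k)%g.
  by rewrite (dist_sym cX (p k) y0); lia.
have := dist_triangle cX (p k.+1) ym (a * p k.+1)%g.
have := dist_triangle cX ym zm (a * p k.+1)%g.
by rewrite (dist_sym cX zm (a * p k.+1)%g); lia.
Qed.

Lemma conjugator_rebuild E :
  (forall k, k < m -> exists2 s, ((a ^ p k) ^ s = a ^ p k.+1)%g & normX s <= E) ->
  exists2 y, (a ^ y)%g = b & normX y <= m * E.
Proof.
move=> step; suff build k : k <= m ->
    exists2 y, (a ^ y = a ^ p k)%g & normX y <= k * E.
  by have [y ay yE] := build m (leqnn m); exists y; rewrite // ay pm.
elim: k => [|k IH] km; first by exists 1%g; rewrite ?p0 ?normX1.
have [y ay yE] := IH (ltnW km); have [s as_ sE] := step k km.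
exists (y * s)%g; first by rewrite conjgM ay.
by apply: leq_trans (normXM genX _ _) _; rewrite mulSn; lia.
Qed.

End ShortestConjugator.

(** There are [O(L)] edges, each replaced by an element of length [O(L^e)] with [e = max(1, n)], and
    [e + 1] is at most [max(3, 2n + 1)]. *)
Lemma csp_bound n : (exists M, forall i, polynomial_csp X H n M i) ->
  exists A, forall a b, (exists x, (a ^ x)%g = b) ->
    exists2 x, (a ^ x)%g = b &
      normX x <= A * (maxn (normX a) (normX b)).+1 ^ (maxn 3 (2 * n + 1)).
Proof.
move=> [M csp].
have [d slim] := hyperbolic_slim cH hypG.1.
set t := (d * 8).+2.
have [c iso] := isolated_bound genX hypG.2 (d * 12 + t * 2).
have [K hK] := entry_exit_bound.
have [K' hK'] := projection_lipschitz genX hypG.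
set B := size (ball X (c.+1 * (d * 4))).
exists (((t + d * 2).+1 * 2 + 2 + B) * (M * (K * 2 + K').+1 ^ n + (K * 3 + K' * 2).+1)).
move=> a b [x0 ax0]; set L := maxn _ _.
have ex : exists k, `[< exists2 x, (a ^ x)%g = b & dH 1%g x = k >].
  by exists (dH 1%g x0); apply/asboolP; exists x0.
case: (ex_minnP ex) => m /asboolP[x ax dx] minm.
have min y : (a ^ y)%g = b -> m <= dH 1%g y.
  by move=> ay; apply: minm; apply/asboolP; exists y.
have [p [p0 pm gp]] := geod_exists cH 1%g x; rewrite dx in pm gp.
have [] := conjugator_rebuild ax p0 pm (fun k => conjugator_step ax p0 pm gp min hK hK' csp).
move=> y ay yb; exists y => //; apply: leq_trans yb _.
have mL := conjugator_length ax p0 pm gp min slim iso.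
rewrite -/L -/B -/t in mL *.
have mL' : m <= ((t + d * 2).+1 * 2 + 2 + B) * L.+1 by nia.
have pw j : 0 < L.+1 ^ j by rewrite expn_gt0.
set e := maxn 1 n.
have KL : (K * 2 + K' * L.+1).+1 <= (K * 2 + K').+1 * L.+1 by nia.
have Ln : L.+1 ^ n <= L.+1 ^ e by rewrite leq_pexp2l// leq_maxr.
have L1 : L.+1 <= L.+1 ^ e by rewrite -{1}[L.+1]expn1 leq_pexp2l// leq_maxl.
have s1 : (K * 2 + K' * L.+1).+1 ^ n <= (K * 2 + K').+1 ^ n * L.+1 ^ e.
  apply: leq_trans (leq_expn n KL) _; rewrite expnMn leq_mul2l Ln; lia.
have s2 : (K * 3 + K' * L.+1 * 2).+1 <= (K * 3 + K' * 2).+1 * L.+1 ^ e by nia.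
have ee : e.+1 <= maxn 3 (2 * n + 1) by rewrite /e; lia.
apply: leq_trans (leq_mul mL' (_ : _ <=
  (M * (K * 2 + K').+1 ^ n + (K * 3 + K' * 2).+1) * L.+1 ^ e)) _.
  rewrite mulnDl leq_add// -mulnA leq_mul2l s1; lia.
rewrite mulnACA -expnS leq_mul2l leq_pexp2l//; lia.
Qed.

End Conjugators.

(** * The bounding polynomial *)

Local Open Scope classical_set_scope.
Local Open Scope ring_scope.

Theorem theoremA (R : realType) (G : groupType) (X : seq G)
    (I : Type) (H : I -> groupClosed G) (Y : I -> seq G)
    (n : nat) (P : {poly R})
    (genX : generates X [set: G])
    (hypG : relatively_hyperbolic R X H)
    (genY : forall i, generates (Y i) [set x | x \in H i])
    (sizeP : size P = n.+1)
    (cspH : forall i, CSP_bounded [set x | x \in H i] (Y i) (fun t : R => P.[t])) :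
  exists Q : {poly R}, size Q = (maxn 3 (2 * n + 1)).+1 /\
    forall a b : G, (exists x : G, (a ^ x)%g = b) ->
      exists x : G, (a ^ x)%g = b /\
        (word_length [set` X] x)%:R <=
          Q.[(maxn (word_length [set` X] a) (word_length [set` X] b))%:R].

Proof.
have [|A hA] := csp_bound genX hypG (n := n).
  apply: (polynomial_csp_uniform genX hypG) => i.
  exact: (polynomial_csp_exists genX hypG (genY i) sizeP (cspH i)).
set D := maxn 3 (2 * n + 1).
(* Taking [A.+1] keeps the leading coefficient nonzero, so the degree is exactly [D]. *)
exists (A.+1%:R *: ('X + 1%:P) ^+ D); split.
  have -> : 'X + 1%:P = 'X - (-1)%:P :> {poly R} by rewrite polyCN opprK.
  by rewrite size_scale ?size_exp_XsubC// pnatr_eq0.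
move=> a b /hA[x ax xA]; exists x; split=> //.
rewrite hornerZ horner_exp !hornerE natr1 -natrX -natrM ler_nat.
by apply: leq_trans xA _; rewrite leq_mul2r leqnSn orbT.
Qed.
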